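(* Let $\Lambda$ be a finite $k$-graph with no sources. For $i\in\{S,T\}$ let $\{f^i_\lambda\}$ be a $\Lambda$-projective system on $(\Lambda^\infty,\mu_i)$ with the standard prefixing and coding maps, and consider the associated monic representations $S_\lambda f=f^S_\lambda\cdot(f\circ\sigma^{d(\lambda)})$ on $L^2(\Lambda^\infty,\mu_S)$ and $T_\lambda f=f^T_\lambda\cdot(f\circ\sigma^{d(\lambda)})$ on $L^2(\Lambda^\infty,\mu_T)$. These representations are unitarily equivalent if and only if $\mu_S$ and $\mu_T$ are equivalent measures and there is a function $h$ on $\Lambda^\infty$ with $$\frac{d\mu_S}{d\mu_T}=|h|^2\qquad\text{and}\qquad f^S_\lambda=\frac{h\circ\sigma^n}{h}\,f^T_\lambda\ \text{ for all }\lambda\in\Lambda^n,\ n\in\mathbb N^k.$$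
   Context: $k$-graph: countable small category with degree $d:\Lambda\to\mathbb N^k$ with unique factorization; finite, no sources. $\Lambda^\infty$ infinite paths with cylinder sets $Z(\lambda)$ and Borel $\sigma$-algebra; standard coding maps $\sigma^m(x)(p,q)=x(p+m,q+m)$ and prefixing maps $\sigma_\lambda(x)=\lambda x$ on $Z(s(\lambda))$. A $\Lambda$-projective system on $(\Lambda^\infty,\mu)$ with standard maps: these maps form a $\Lambda$-semibranching function system (for each $m$, $\{Z(\lambda)\}_{\lambda\in\Lambda^m}$ partitions $\Lambda^\infty$; $\mu(Z(v))>0$; $\mu\circ\sigma_\lambda\ll\mu$ with positive derivative on $Z(s(\lambda))$), plus $f_\lambda\in L^2(\Lambda^\infty,\mu)$ with $|f_\lambda|^2=d(\mu\circ\sigma_\lambda^{-1})/d\mu$ (push-forward, nonzero a.e. on $Z(\lambda)$) and $f_\lambda(f_\nu\circ\sigma^{d(\lambda)})=f_{\lambda\nu}$ when $s(\lambda)=r(\nu)$. Such a system gives a monic representation $f\mapsto f_\lambda\cdot(f\circ\sigma^{d(\lambda)})$ of $C^*(\Lambda)$ (monic: $t_\lambda\neq 0$ and some vector $\xi$ with $\overline{\operatorname{span}}\{t_\lambda t_\lambda^*\xi\}$ the whole space). *)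

(* Defs.v *)
From HB Require Import structures.
From Stdlib Require Import ClassicalEpsilon.
From mathcomp Require Import all_boot all_order all_algebra.
From mathcomp Require Import all_classical all_reals all_analysis.
From mathcomp.real_closed Require Import complex.

Set Implicit Arguments.
Unset Strict Implicit.
Unset Printing Implicit Defensive.

Import Order.TTheory GRing.Theory Num.Theory.

Local Open Scope classical_set_scope.
Local Open Scope ring_scope.

Definition Nk (k : nat) := 'I_k -> nat.
Definition zeroNk k : Nk k := fun _ => 0%N.
Definition addNk k (m n : Nk k) : Nk k := fun i => (m i + n i)%N.
Definition subNk k (m n : Nk k) : Nk k := fun i => (m i - n i)%N.
Definition leNk k (m n : Nk k) : bool := [forall i, (m i <= n i)%N].

Lemma le0Nk k (n : Nk k) : leNk (@zeroNk k) n.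
Proof. by apply/forallP. Qed.

Lemma leNk_add k (m p q : Nk k) : leNk p q -> leNk (addNk p m) (addNk q m).
Proof.
by move=> /forallP h; apply/forallP => i; rewrite /addNk leq_add2r; exact: h.
Qed.

(* kcomp l m is the composite "l m" (l after m), meaningful when        *)
(* ks l = kr m.  Vertices are the objects; kid v the identity at v.     *)

Record kgraph (k : nat) := KGraph {
  kvert : Type;
  kmor : Type;
  kr : kmor -> kvert;
  ks : kmor -> kvert;
  kid : kvert -> kmor;
  kcomp : kmor -> kmor -> kmor;
  kd : kmor -> Nk k;
  kmor_countable : exists c : kmor -> nat, injective c;
  kr_id : forall v, kr (kid v) = v;
  ks_id : forall v, ks (kid v) = v;
  kr_comp : forall l m, ks l = kr m -> kr (kcomp l m) = kr l;
  ks_comp : forall l m, ks l = kr m -> ks (kcomp l m) = ks m;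
  kcomp_idl : forall l, kcomp (kid (kr l)) l = l;
  kcomp_idr : forall l, kcomp l (kid (ks l)) = l;
  kcompA : forall l m n, ks l = kr m -> ks m = kr n ->
    kcomp l (kcomp m n) = kcomp (kcomp l m) n;
  kd_comp : forall l m, ks l = kr m -> kd (kcomp l m) = addNk (kd l) (kd m);
  kfactor : forall l (m n : Nk k), kd l = addNk m n ->
    exists! mn : kmor * kmor,
      [/\ ks mn.1 = kr mn.2, kd mn.1 = m, kd mn.2 = n & l = kcomp mn.1 mn.2]
}.

Arguments kr {k L} : rename.
Arguments ks {k L} : rename.
Arguments kid {k L} : rename.
Arguments kcomp {k L} : rename.
Arguments kd {k L} : rename.

Definition finite_kgraph k (L : kgraph k) : Prop :=
  forall n : Nk k, finite_set [set l : kmor L | kd l = n].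

Definition no_sources k (L : kgraph k) : Prop :=
  forall (v : kvert L) (n : Nk k), exists l : kmor L, kr l = v /\ kd l = n.

(* Infinite paths: degree-preserving functors Omega_k -> Lambda, where  *)
(* Omega_k = {(p,q) in N^k x N^k | p <= q}, d(p,q) = q - p,             *)
(* (p,q)(q,r) = (p,r).                                                  *)

Definition Omega k := {pq : Nk k * Nk k | leNk pq.1 pq.2}.
Definition omega k (p q : Nk k) (h : leNk p q) : Omega k :=
  exist (fun pq : Nk k * Nk k => leNk pq.1 pq.2) (p, q) h.

Definition is_kpath k (L : kgraph k) (x : Omega k -> kmor L) : Prop :=
  (forall p q (h : leNk p q), kd (x (omega h)) = subNk q p) /\
  (forall p q r (hpq : leNk p q) (hqr : leNk q r) (hpr : leNk p r),
     ks (x (omega hpq)) = kr (x (omega hqr)) /\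
     x (omega hpr) = kcomp (x (omega hpq)) (x (omega hqr))).

Definition kpath k (L : kgraph k) := {x : Omega k -> kmor L | is_kpath x}.

Definition kpath_seg k (L : kgraph k) (x : kpath L) (n : Nk k) : kmor L :=
  sval x (omega (le0Nk n)).

Definition cyl k (L : kgraph k) (l : kmor L) : set (kpath L) :=
  [set x | kpath_seg x (kd l) = l].

Definition shift_fun k (L : kgraph k) (m : Nk k) (x : Omega k -> kmor L) :
  Omega k -> kmor L :=
  fun pq => x (omega (leNk_add m (proj2_sig pq))).

Lemma is_kpath_shift k (L : kgraph k) (m : Nk k) (x : Omega k -> kmor L) :
  is_kpath x -> is_kpath (shift_fun m x).
Proof.
move=> [hd hc]; split.
  move=> p q h; rewrite /shift_fun /= hd.
  by apply: boolp.funext => i; rewrite /subNk /addNk subnDr.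
by move=> p q r hpq hqr hpr; rewrite /shift_fun /=; exact: hc.
Qed.

Definition kshift k (L : kgraph k) (m : Nk k) (x : kpath L) : kpath L :=
  exist _ (shift_fun m (sval x)) (is_kpath_shift m (svalP x)).

(* prefixing map sigma_l : Z(s l) -> Z(l), x |-> l x, i.e. the unique
   y in Z(l) with sigma^{d l}(y) = x (chosen by Hilbert epsilon; its
   value off Z(s l) is irrelevant). *)
Definition prefix k (L : kgraph k) (l : kmor L) (x : kpath L) : kpath L :=
  epsilon (inhabits x) (fun y => cyl l y /\ kshift (kd l) y = x).

(* The measurable space (Lambda^infty, Borel sigma-algebra), the        *)
(* sigma-algebra generated by the cylinder sets.  MathComp requires a   *)
(* pointed carrier; the point x0 plays no other role.                   *)

Definition kpathP k (L : kgraph k) (x0 : kpath L) := kpath L.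
HB.instance Definition _ k (L : kgraph k) (x0 : kpath L) :=
  boolp.gen_eqMixin (kpathP x0).
HB.instance Definition _ k (L : kgraph k) (x0 : kpath L) :=
  boolp.gen_choiceMixin (kpathP x0).
HB.instance Definition _ k (L : kgraph k) (x0 : kpath L) :=
  isPointed.Build (kpathP x0) x0.

Definition cylinders k (L : kgraph k) (x0 : kpath L) : set (set (kpathP x0)) :=
  [set A | exists l : kmor L, A = cyl l].

Definition Linf k (L : kgraph k) (x0 : kpath L) :=
  g_sigma_algebraType (@cylinders k L x0).

Section L2.
Context {d : measure_display} {T : measurableType d} {R : realType}.

Definition cabs2 (z : R[i]) : R := ComplexField.Normc.normc z ^+ 2.

Definition cmeasurable (f : T -> R[i]) : Prop :=
  measurable_fun setT (fun x => complex.Re (f x)) /\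
  measurable_fun setT (fun x => complex.Im (f x)).

Definition nrm2 (mu : {measure set T -> \bar R}) (f : T -> R[i]) : \bar R :=
  (\int[mu]_x (cabs2 (f x))%:E)%E.

Definition L2 (mu : {measure set T -> \bar R}) (f : T -> R[i]) : Prop :=
  cmeasurable f /\ (nrm2 mu f < +oo)%E.

Definition ae_eq (mu : {measure set T -> \bar R}) (f g : T -> R[i]) : Prop :=
  {ae mu, forall x, f x = g x}.

Definition equiv_measures (mu nu : {measure set T -> \bar R}) : Prop :=
  forall A, measurable A -> (mu A = 0%E <-> nu A = 0%E).

(* Unitary equivalence of the representations l |-> S l and l |-> Tp l of
   C*(Lambda) on L^2(muS), L^2(muT): a unitary U : L^2(muS) -> L^2(muT)
   (well defined on a.e.-classes, linear, isometric, onto) with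
   U S_l = T_l U for every l (equivalently U S_l U^* = T_l on the
   generators s_l of C*(Lambda)). *)
Definition unitarily_equivalent (muS muT : {measure set T -> \bar R})
    (I : Type) (S Tp : I -> (T -> R[i]) -> (T -> R[i])) : Prop :=
  exists U : (T -> R[i]) -> (T -> R[i]),
    [/\ (forall f, L2 muS f -> L2 muT (U f)),
        (forall f g, L2 muS f -> L2 muS g -> ae_eq muS f g ->
          ae_eq muT (U f) (U g)),
        (forall (a : R[i]) f g, L2 muS f -> L2 muS g ->
          ae_eq muT (U (fun x => a * f x + g x)) (fun x => a * U f x + U g x)),
        (forall f, L2 muS f -> nrm2 muT (U f) = nrm2 muS f) /\
        (forall g, L2 muT g -> exists2 f, L2 muS f & ae_eq muT (U f) g)
      & (forall l f, L2 muS f -> ae_eq muT (U (S l f)) (Tp l (U f)))].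

End L2.

Section ProjSystem.
Context {R : realType} {k : nat} {L : kgraph k} (x0 : kpath L).

Definition semibranching (mu : {measure set (Linf x0) -> \bar R}) : Prop :=
  [/\
      forall (m : Nk k) (x : Linf x0), exists! l : kmor L, kd l = m /\ cyl l x,
      forall v : kvert L, (0 < mu (cyl (kid v)))%E &
      (* mu o sigma_l << mu on Z(s l), with a.e. positive derivative *)
      forall l : kmor L, exists Phi : Linf x0 -> R,
        [/\ measurable_fun setT Phi, forall x, 0 <= Phi x,
            forall A : set (Linf x0), measurable A -> A `<=` cyl (kid (ks l)) ->
              mu (prefix l @` A) = (\int[mu]_(x in A) (Phi x)%:E)%E
          & {ae mu, forall x, cyl (kid (ks l)) x -> 0 < Phi x}]].

Definition proj_system (mu : {measure set (Linf x0) -> \bar R})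
    (f : kmor L -> Linf x0 -> R[i]) : Prop :=
  [/\ semibranching mu,
      forall l, L2 mu (f l),
      (* |f_l|^2 = d(mu o sigma_l^{-1}) / d mu  (push-forward of mu|Z(s l)) *)
      forall l (A : set (Linf x0)), measurable A ->
        mu (cyl (kid (ks l)) `&` prefix l @^-1` A)
          = (\int[mu]_(x in A) (cabs2 (f l x))%:E)%E,
      forall l, {ae mu, forall x, cyl l x -> f l x != 0}
    &
      forall l n, ks l = kr n ->
        {ae mu, forall x, f l x * f n (kshift (kd l) x) = f (kcomp l n) x}].

Definition proj_rep (f : kmor L -> Linf x0 -> R[i]) (l : kmor L)
    (g : Linf x0 -> R[i]) : Linf x0 -> R[i] :=
  fun x => f l x * g (kshift (kd l) x).

End ProjSystem.

(* Main.v *)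
(** An intertwining unitary [U] maps functions supported on a cylinder [Z(l)]
    to functions supported on [Z(l)], because multiplication by the indicator
    of [Z(l)] is [S_l S_l^*]: every [g] supported on [Z(l)] is [S_l F] with
    [F = (g / f_l) o sigma_l].  Finitely many cylinders of each degree partition
    the path space, so [U] commutes with the indicators of cylinders.  The sets
    whose indicators commute with [U] form a sigma-algebra, hence [U] commutes
    with all Borel indicators, and [h := U 1] satisfies
    [mu_S A = int_A |h|^2 d mu_T].  For [f] in [L^2] and a constant [c], the
    isometry applied to [(f - c) 1_A] gives
    [int_A |U f - c h|^2 d mu_T = int_A |f - c|^2 |h|^2 d mu_T] for all [A], so
    [|U f - c h| = |f - c| |h|] almost everywhere; taking [c = 0, 1, i] forces
    [U f = h f].  Then [U S_l 1 = T_l U 1] reads [h f^S_l = f^T_l (h o sigma^n)].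
    Conversely multiplication by [h] is the required unitary. *)
Require Import Defs.
From HB Require Import structures.
From Stdlib Require Import ClassicalEpsilon.
From mathcomp Require Import all_boot all_order all_algebra.
From mathcomp Require Import all_classical all_reals all_analysis.
From mathcomp Require Import measurable_realfun ring lra.
From mathcomp.real_closed Require Import complex.

(* [ks] and [ae_eq] are shadowed by the libraries above. *)
Import Defs.
Import Order.TTheory GRing.Theory Num.Theory.
Local Open Scope classical_set_scope.
Local Open Scope ring_scope.

(** * Infinite paths *)

Section KGraph.
Set Implicit Arguments.
Unset Strict Implicit.
Context {k : nat} {L : kgraph k}.
Implicit Types (l m a b c : kmor L) (p q n : Nk k) (x y : kpath L).

Lemma addNkI n p q : addNk n p = addNk n q -> p = q.
Proof.
move=> e; apply/funext => i; have := congr1 (fun f => f i) e.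
by rewrite /addNk => /addnI.
Qed.

Lemma addNkC p q : addNk p q = addNk q p.
Proof. by apply/funext => i; rewrite /addNk addnC. Qed.

Lemma add0Nk n : addNk (@zeroNk k) n = n.
Proof. by apply/funext => i; rewrite /addNk add0n. Qed.

Lemma addNk0 n : addNk n (@zeroNk k) = n.
Proof. by apply/funext => i; rewrite /addNk addn0. Qed.

Lemma subNkKC p q : leNk p q -> addNk p (subNk q p) = q.
Proof.
by move=> /forallP h; apply/funext => i; rewrite /addNk /subNk subnKC.
Qed.

Lemma leNk_addr p q : leNk p (addNk p q).
Proof. by apply/forallP => i; rewrite /addNk leq_addr. Qed.

Lemma leNk_addl p q : leNk p (addNk q p).
Proof. by rewrite addNkC leNk_addr. Qed.

(** Cancelling in $\mathbb N^k$ gives [kd b = kd b'], so both pairs factor one morphism at the same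
    pair of degrees, and unique factorization identifies them. *)
Lemma kfactor_inj a b a' b' : ks a = kr b -> ks a' = kr b' -> kd a = kd a' ->
  kcomp a b = kcomp a' b' -> a = a' /\ b = b'.
Proof.
move=> ab ab' dd e.
have db : kd b = kd b'.
  by apply: (@addNkI (kd a)); rewrite -kd_comp// e kd_comp// dd.
have [mn [_ U]] := kfactor (kd_comp ab).
have e1 : mn = (a, b) by apply: U.
have e2 : mn = (a', b') by apply: U.
by move: e2; rewrite e1 => -[].
Qed.

Lemma kfactor_injl a b a' b' : ks a = kr b -> ks a' = kr b' -> kd a = kd a' ->
  kcomp a b = kcomp a' b' -> a = a'.
Proof. by move=> h1 h2 h3 h4; have [] := kfactor_inj h1 h2 h3 h4. Qed.

Lemma kfactor_injr a b a' b' : ks a = kr b -> ks a' = kr b' -> kd a = kd a' ->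
  kcomp a b = kcomp a' b' -> b = b'.
Proof. by move=> h1 h2 h3 h4; have [] := kfactor_inj h1 h2 h3 h4. Qed.

Lemma kd_id (v : kvert L) : kd (kid v) = @zeroNk k.
Proof.
have h : ks (kid v) = kr (kid v) by rewrite kr_id ks_id.
have := kcomp_idr (kid v); rewrite ks_id => e.
by apply: (@addNkI (kd (kid v))); rewrite -kd_comp// e addNk0.
Qed.

(** Composing [l] with the identity on either side gives two factorizations of [l] at degrees
    $(0,0)$; their left factors must agree. *)
Lemma kmor_deg0 l : kd l = @zeroNk k -> l = kid (kr l).
Proof.
move=> l0; apply: (@kfactor_injl l (kid (ks l)) (kid (kr l)) l).
- by rewrite kr_id.
- by rewrite ks_id.
- by rewrite l0 kd_id.
- by rewrite kcomp_idl kcomp_idr.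
Qed.

Definition seg x p q (h : leNk p q) := sval x (omega h).

Lemma kd_seg x p q (h : leNk p q) : kd (seg x h) = subNk q p.
Proof. by case: x => x [hd hc]; exact: hd. Qed.

Lemma seg_comp x p q n (hpq : leNk p q) (hqn : leNk q n) (hpn : leNk p n) :
  ks (seg x hpq) = kr (seg x hqn) /\
  seg x hpn = kcomp (seg x hpq) (seg x hqn).
Proof. by case: x => x [hd hc]; exact: hc. Qed.

Lemma kd_kpath_seg x n : kd (kpath_seg x n) = n.
Proof. by rewrite [LHS]kd_seg; apply/funext => i; rewrite /subNk subn0. Qed.

Lemma kpath_seg_comp x p q (h : leNk p q) :
  ks (kpath_seg x p) = kr (seg x h) /\
  kpath_seg x q = kcomp (kpath_seg x p) (seg x h).
Proof. exact: seg_comp. Qed.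

(** The value $x(p,q)$ is recovered by cancelling $x(0,p)$ on the left of $x(0,q)$. *)
Lemma kpath_seg_inj x y : (forall n, kpath_seg x n = kpath_seg y n) -> x = y.
Proof.
move=> e; suff E : sval x = sval y.
  case: x y E {e} => x xP [y yP] /= E; rewrite E in xP *.
  by rewrite (Prop_irrelevance xP yP).
apply/funext => -[[p q] h].
have [x1 x2] := kpath_seg_comp x h; have [y1 y2] := kpath_seg_comp y h.
by apply: (kfactor_injr x1 y1); rewrite -?x2 -?y2 e.
Qed.

(** The value at $(p,q)$ is a chosen [b] with [Y q = kcomp (Y p) b]; functoriality follows by
    cancelling [Y p] on the left. *)
Lemma kpath_of_coherent (Y : Nk k -> kmor L) :
  (forall q, kd (Y q) = q) ->
  (forall p q, leNk p q -> exists b, ks (Y p) = kr b /\ Y q = kcomp (Y p) b) ->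
  exists y, forall q, kpath_seg y q = Y q.
Proof.
move=> dY cY.
have hY (pq : Omega k) : { b | ks (Y (sval pq).1) = kr b /\
    Y (sval pq).2 = kcomp (Y (sval pq).1) b}.
  by apply: cid; case: pq => -[p q] /= h; exact: cY.
pose z pq := sval (hY pq).
have zE p q (h : leNk p q) : ks (Y p) = kr (z (omega h)) /\
    Y q = kcomp (Y p) (z (omega h)) by exact: (svalP (hY (omega h))).
have zP : is_kpath z.
  split=> [p q h|p q n hpq hqn hpn].
    have [e1 e2] := zE _ _ h; apply: (@addNkI p).
    by rewrite subNkKC// -{1}(dY p) -kd_comp// -e2 dY.
  have [p1 p2] := zE _ _ hpq; have [q1 q2] := zE _ _ hqn.
  have [r1 r2] := zE _ _ hpn.
  have e : ks (z (omega hpq)) = kr (z (omega hqn)) by rewrite -q1 p2 ks_comp.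
  split=> //; apply: (@kfactor_injr (Y p) _ (Y p)) => //; first by rewrite kr_comp.
  by rewrite -r2 q2 p2 kcompA.
exists (exist _ z zP) => q; rewrite /kpath_seg /=.
have [e1 ->] := zE _ _ (le0Nk q).
by rewrite (kmor_deg0 (dY (@zeroNk k))) -[kr (Y _)]ks_id -kmor_deg0// e1 kcomp_idl.
Qed.

Lemma khead l p q : kd l = addNk p q -> exists a, exists b,
  [/\ ks a = kr b, kd a = p, kd b = q & l = kcomp a b].
Proof. by move=> /kfactor[[a b] [h _]]; exists a, b. Qed.

Lemma cyl_id x (v : kvert L) : cyl (kid v) x <-> kr (kpath_seg x (@zeroNk k)) = v.
Proof.
rewrite /cyl /= kd_id; split=> [->|<-]; first by rewrite kr_id.
by apply: kmor_deg0; rewrite kd_kpath_seg.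
Qed.

Lemma kr_kpath_seg x n : kr (kpath_seg x n) = kr (kpath_seg x (@zeroNk k)).
Proof.
have [e1 e2] := kpath_seg_comp x (le0Nk n).
by rewrite e2 kr_comp.
Qed.

Lemma kpath_seg_shift x n q : ks (kpath_seg x n) = kr (kpath_seg (kshift n x) q) /\
  kpath_seg x (addNk n q) = kcomp (kpath_seg x n) (kpath_seg (kshift n x) q).
Proof.
have -> : kpath_seg (kshift n x) q = seg x (leNk_add n (le0Nk q)) by [].
have := kpath_seg_comp x (leNk_add n (le0Nk q)).
by move: (seg x _) => s; rewrite add0Nk (addNkC q).
Qed.

(** The initial segment of $lx$ of degree $q$ must be the left factor of degree $q$ of $l\,x(0,q)$,
    and these factors form a coherent family. *)
Lemma prefix_exists l x : cyl (kid (ks l)) x ->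
  exists y, cyl l y /\ kshift (kd l) y = x.
Proof.
move=> /cyl_id lx.
have lxq q : ks l = kr (kpath_seg x q) by rewrite kr_kpath_seg.
pose w q := kcomp l (kpath_seg x q).
have dw q : kd (w q) = addNk q (kd l).
  by rewrite kd_comp// kd_kpath_seg addNkC.
have hY q : {a | exists b, [/\ ks a = kr b, kd a = q, kd b = kd l & w q = kcomp a b]}.
  by apply: cid; exact: khead.
pose Y q := sval (hY q).
have YP q : exists b, [/\ ks (Y q) = kr b, kd (Y q) = q, kd b = kd l &
  w q = kcomp (Y q) b] by exact: (svalP (hY q)).
have dY q : kd (Y q) = q by have [b []] := YP q.
have wE p q (h : leNk p q) : ks (w p) = kr (seg x h) /\ w q = kcomp (w p) (seg x h).
  have [e1 e2] := kpath_seg_comp x h.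
  by rewrite /w ks_comp// e2 kcompA.
(* The left factor of degree $p$ may be read off any longer product [w q], since [w q] extends [w p]
   on the right. *)
have YE p q a b : leNk p q -> w q = kcomp a b -> ks a = kr b -> kd a = p -> Y p = a.
  move=> h wab ab da; have [c [Yc _ _ wc]] := YP p; have [w1 w2] := wE _ _ h.
  have cx : ks c = kr (seg x h) by rewrite -w1 wc ks_comp.
  apply: (@kfactor_injl (Y p) (kcomp c (seg x h)) a b).
  - by rewrite kr_comp.
  - by [].
  - by rewrite dY.
  - by rewrite -wab w2 wc kcompA.
have [y yY] : exists y, forall q, kpath_seg y q = Y q.
  apply: kpath_of_coherent => // p q h.
  have [c [Yc _ _ wc]] := YP q.
  have [a [b [ab da db Yab]]] := khead (etrans (dY q) (esym (subNkKC h))).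
  have bc : ks b = kr c by rewrite -Yc Yab ks_comp.
  exists b; suff -> : Y p = a by [].
  apply: (YE p q a (kcomp b c)) => //; last by rewrite kr_comp.
  by rewrite wc Yab kcompA.
(* The product [w q] itself has degree $d(l)+q$ and is an initial piece of [w (addNk (kd l) q)]. *)
have Yl q : Y (addNk (kd l) q) = kcomp l (kpath_seg x q).
  have h : leNk q (addNk (kd l) q) by exact: leNk_addl.
  have [w1 w2] := wE _ _ h.
  apply: (YE _ (addNk (kd l) q) _ (seg x h)) => //; last by rewrite dw addNkC.
  by apply/forallP.
have yl : kpath_seg y (kd l) = l.
  rewrite yY -[kd l]addNk0 Yl.
  have [e1 e2] := kpath_seg_comp x (le0Nk (@zeroNk k)).
  by rewrite (kmor_deg0 (kd_kpath_seg x (@zeroNk k))) -lxq kcomp_idr.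
exists y; split=> //; apply: kpath_seg_inj => q.
have [e1 e2] := kpath_seg_shift y (kd l) q.
apply: (@kfactor_injr _ _ l _ e1) => //; first by rewrite yl.
by rewrite -e2 yY Yl.
Qed.

Lemma prefixP l x : cyl (kid (ks l)) x ->
  cyl l (prefix l x) /\ kshift (kd l) (prefix l x) = x.
Proof. by move=> /prefix_exists; exact: epsilon_spec. Qed.

Lemma cyl_shift l x : cyl l x -> cyl (kid (ks l)) (kshift (kd l) x).
Proof.
move=> lx; apply/cyl_id; have [<- _] := kpath_seg_shift x (kd l) (@zeroNk k).
by rewrite [kpath_seg x _]lx.
Qed.

(** Both paths have the segment $l\,\sigma^{d(l)}(x)(0,n)$ of degree $d(l)+n$, whose left factor of
    degree $n$ is the segment of either path. *)
Lemma cyl_shift_inj l x y : cyl l x -> cyl l y ->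
  kshift (kd l) x = kshift (kd l) y -> x = y.
Proof.
move=> lx ly e; apply: kpath_seg_inj => n.
have e' : kpath_seg x (addNk (kd l) n) = kpath_seg y (addNk (kd l) n).
  have [_ ->] := kpath_seg_shift x (kd l) n.
  by have [_ ->] := kpath_seg_shift y (kd l) n; rewrite e lx ly.
have h : leNk n (addNk (kd l) n) by exact: leNk_addl.
have [x1 x2] := kpath_seg_comp x h; have [y1 y2] := kpath_seg_comp y h.
by apply: (kfactor_injl x1 y1); rewrite ?kd_kpath_seg// -x2 -y2.
Qed.

Lemma shiftK l x : cyl l x -> prefix l (kshift (kd l) x) = x.
Proof.
move=> lx; have [y1 y2] := prefixP (cyl_shift lx).
exact: cyl_shift_inj y1 lx y2.
Qed.

End KGraph.

(** * Complex-valued measurable functions and densities *)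

Section ComplexMeasurable.
Set Implicit Arguments.
Unset Strict Implicit.
Context {R : realType}.
Implicit Types z w : R[i].

Lemma cabs2E z : cabs2 z = complex.Re z ^+ 2 + complex.Im z ^+ 2.
Proof.
by case: z => a b; rewrite /cabs2 /= sqr_sqrtr// addr_ge0// sqr_ge0.
Qed.

Lemma cabs2_ge0 z : 0 <= cabs2 z.
Proof. exact: sqr_ge0. Qed.

Lemma cabs20 : cabs2 (0 : R[i]) = 0.
Proof. by rewrite cabs2E /= expr0n /= addr0. Qed.

Lemma cabs21 : cabs2 (1 : R[i]) = 1.
Proof. by rewrite cabs2E /= expr0n expr1n addr0. Qed.

Lemma cabs2_eq0 z : cabs2 z = 0 -> z = 0.
Proof.
by move=> /eqP; rewrite expf_eq0 /= => /eqP; exact: ComplexField.Normc.eq0_normc.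
Qed.

Lemma cabs2M z w : cabs2 (z * w) = cabs2 z * cabs2 w.
Proof. by rewrite /cabs2 ComplexField.Normc.normcM exprMn. Qed.

Lemma cabs2D_le z w : cabs2 (z + w) <= 2 * cabs2 z + 2 * cabs2 w.
Proof.
rewrite !cabs2E; case: z w => a b [c e] /=; rewrite -subr_ge0.
have -> : 2 * (a ^+ 2 + b ^+ 2) + 2 * (c ^+ 2 + e ^+ 2) -
  ((a + c) ^+ 2 + (b + e) ^+ 2) = (a - c) ^+ 2 + (b - e) ^+ 2 by ring.
by rewrite addr_ge0// sqr_ge0.
Qed.

(** A complex number is determined by its distances to $0$, $1$ and $i$: differences of the squared
    distances are affine in the real and imaginary parts. *)
Lemma cabs2_inj z w : cabs2 z = cabs2 w -> cabs2 (z - 1) = cabs2 (w - 1) ->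
  cabs2 (z - 'i%C) = cabs2 (w - 'i%C) -> z = w.
Proof.
rewrite !cabs2E; case: z w => a b [c e] /= h0 h1 hi.
have -> : a = c by lra.
by have -> : b = e by lra.
Qed.

Context {d : measure_display} {T : measurableType d}.
Implicit Types (f g : T -> R[i]) (A : set T).

Definition cut A f : T -> R[i] := fun x => if x \in A then f x else 0.

Lemma cmeasurable_cst z : cmeasurable (fun _ : T => z).
Proof. by split; exact: measurable_cst. Qed.

Lemma cmeasurableD f g : cmeasurable f -> cmeasurable g ->
  cmeasurable (fun x => f x + g x).
Proof.
move=> [f1 f2] [g1 g2]; split.
  rewrite [X in measurable_fun _ X](_ : _ =
    (fun x => complex.Re (f x) + complex.Re (g x))); first exact: measurable_funD.
  by apply/funext => x; case: (f x) (g x) => ? ? [].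
rewrite [X in measurable_fun _ X](_ : _ =
  (fun x => complex.Im (f x) + complex.Im (g x))); first exact: measurable_funD.
by apply/funext => x; case: (f x) (g x) => ? ? [].
Qed.

Lemma cmeasurableM f g : cmeasurable f -> cmeasurable g ->
  cmeasurable (fun x => f x * g x).
Proof.
move=> [f1 f2] [g1 g2]; split.
  rewrite [X in measurable_fun _ X](_ : _ = (fun x =>
    complex.Re (f x) * complex.Re (g x) - complex.Im (f x) * complex.Im (g x))).
    by apply: measurable_funB; exact: measurable_funM.
  by apply/funext => x; case: (f x) (g x) => ? ? [].
rewrite [X in measurable_fun _ X](_ : _ = (fun x =>
  complex.Re (f x) * complex.Im (g x) + complex.Im (f x) * complex.Re (g x))).
  by apply: measurable_funD; exact: measurable_funM.
by apply/funext => x; case: (f x) (g x) => ? ? [].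
Qed.

Lemma measurable_cabs2 f : cmeasurable f ->
  measurable_fun setT (fun x => cabs2 (f x)).
Proof.
move=> [f1 f2]; under eq_fun do rewrite cabs2E.
by apply: measurable_funD; exact: measurable_funX.
Qed.

Lemma cmeasurableV f : cmeasurable f -> cmeasurable (fun x => (f x)^-1).
Proof.
move=> mf; have [f1 f2] := mf.
have m2 : measurable_fun setT (fun x => (cabs2 (f x))^-1).
  (* The power $-1$ agrees with the inverse also at $0$, where both take the value $0$. *)
  under eq_fun do rewrite -powR_inv1 ?cabs2_ge0//.
  exact: (measurableT_comp (measurable_powR _) (measurable_cabs2 mf)).
split.
  rewrite [X in measurable_fun _ X](_ : _ = (fun x =>
    complex.Re (f x) * (cabs2 (f x))^-1)); first exact: measurable_funM.
  by apply/funext => x; rewrite cabs2E; case: (f x).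
rewrite [X in measurable_fun _ X](_ : _ = (fun x =>
  - (complex.Im (f x) * (cabs2 (f x))^-1))).
  by apply: measurableT_comp => //; exact: measurable_funM.
by apply/funext => x; rewrite cabs2E; case: (f x).
Qed.

Lemma cmeasurable_cut A f : measurable A -> cmeasurable f -> cmeasurable (cut A f).
Proof.
move=> mA [f1 f2]; split.
  rewrite [X in measurable_fun _ X](_ : _ = (fun x => complex.Re (f x) * \1_A x)).
    by apply: measurable_funM => //; exact: measurable_indic.
  by apply/funext => x; rewrite /cut indicE; case: ifP; rewrite (mulr1, mulr0).
rewrite [X in measurable_fun _ X](_ : _ = (fun x => complex.Im (f x) * \1_A x)).
  by apply: measurable_funM => //; exact: measurable_indic.
by apply/funext => x; rewrite /cut indicE; case: ifP; rewrite (mulr1, mulr0).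
Qed.

Lemma measurable_ecabs2 A f : measurable A -> cmeasurable f ->
  measurable_fun A (fun x => (cabs2 (f x))%:E).
Proof.
by move=> mA /measurable_cabs2 mf; apply/measurable_EFinP; exact: measurable_funTS.
Qed.

Lemma ecabs2_ge0 z : (0 <= (cabs2 z)%:E)%E.
Proof. by rewrite lee_fin cabs2_ge0. Qed.

Lemma ecabs2_cut A f x : (cabs2 (cut A f x))%:E = ((fun x => (cabs2 (f x))%:E) \_ A) x.
Proof. by rewrite /cut patchE; case: ifP => // _; rewrite cabs20. Qed.

Lemma cmeasurable_comp d' (T' : measurableType d') (phi : T' -> T) f :
  measurable_fun setT phi -> cmeasurable f -> cmeasurable (fun x => f (phi x)).
Proof.
by move=> mphi [f1 f2]; split;
  [exact: (measurableT_comp f1)|exact: (measurableT_comp f2)].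
Qed.

End ComplexMeasurable.

(** * Integration against a measure with a density *)

Section Density.
Set Implicit Arguments.
Unset Strict Implicit.
Context {d : measure_display} {T : measurableType d} {R : realType}.
Local Open Scope ereal_scope.
Import HBNNSimple.

(** Monotone convergence along simple functions increasing to [f] reduces both sides to indicators
    of level sets, where the claim is the hypothesis on [nu]. *)
Lemma ge0_integral_density (mu nu : {measure set T -> \bar R}) (w : T -> R)
    (f : T -> \bar R) :
  measurable_fun setT w -> (forall x, (0 <= w x)%R) ->
  (forall A, measurable A -> nu A = \int[mu]_(x in A) (w x)%:E) ->
  measurable_fun setT f -> (forall x, 0 <= f x) ->
  \int[nu]_x f x = \int[mu]_x (f x * (w x)%:E).
Proof.
move=> mw w0 nuE mf f0.
have mwE : measurable_fun setT (EFin \o w) by exact/measurable_EFinP.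
pose h := nnsfun_approx measurableT mf.
have hf x : (h n x)%:E @[n --> \oo] --> f x.
  by apply: cvg_nnsfun_approx.
have ndh x m n : (m <= n)%N -> (h m x)%:E <= (h n x)%:E.
  by move=> mn; rewrite lee_fin; exact/lefP/nd_nnsfun_approx.
have -> : \int[nu]_x f x = limn (fun n => \int[nu]_x (h n x)%:E).
  rewrite -monotone_convergence//.
  - by apply: eq_integral => x _; apply/esym/cvg_lim => //; exact: hf.
  - by move=> n; exact/measurable_EFinP/measurable_funP.
  - by move=> n x _; rewrite lee_fin.
  - by move=> x _ m n; exact: ndh.
have -> : \int[mu]_x (f x * (w x)%:E) =
    limn (fun n => \int[mu]_x ((h n x)%:E * (w x)%:E)).
  rewrite -monotone_convergence//.
  - apply: eq_integral => x _; apply/esym/cvg_lim => //.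
    by apply: cvgeZr => //; exact: hf.
  - by move=> n; apply: emeasurable_funM => //; exact/measurable_EFinP/measurable_funP.
  - by move=> n x _; rewrite mule_ge0// lee_fin.
  - by move=> x _ m n mn; rewrite lee_wpmul2r ?lee_fin//; have := ndh x _ _ mn.
congr (limn _); apply/funext => n.
have mi r : measurable_fun setT (fun x => (r * \1_(h n @^-1` [set r]) x)%:E).
  by apply/measurable_EFinP; exact: measurable_funM.
transitivity (\int[nu]_x
   (\sum_(y \in range (h n)) (y * \1_(h n @^-1` [set y]) x)%:E)).
  by apply: eq_integral => t _; rewrite /= fimfunE -fsumEFin.
rewrite ge0_integral_fsum//; last by move=> m y Ey; exact: nnfun_muleindic_ge0.
transitivity (\int[mu]_x (\sum_(y \in range (h n))
    (y * \1_(h n @^-1` [set y]) x)%:E * (w x)%:E)); last first.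
  apply: eq_integral => x _.
  rewrite -ge0_mule_fsuml => [|y]; last exact: nnfun_muleindic_ge0.
  by rewrite fsumEFin // -(fimfunE _ x).
rewrite ge0_integral_fsum//; last 2 first.
  - by move=> y; exact: emeasurable_funM.
  - by move=> m y Ey; rewrite mule_ge0 ?lee_fin// -lee_fin nnfun_muleindic_ge0.
apply: eq_fsbigr => r rhn.
under eq_integral do rewrite EFinM.
rewrite integralZl_indic_nnsfun => //.
under [RHS]eq_integral do rewrite EFinM -muleA.
rewrite ge0_integralZl//.
- under [in RHS]eq_integral do rewrite muleC.
  rewrite [in RHS](eq_integral ((EFin \o w) \_ (h n @^-1` [set r]))); last first.
    by move=> x xE; rewrite epatch_indic.
  by rewrite -integral_mkcond integral_indic// setIT nuE.
- by apply: emeasurable_funM => //; exact/measurable_EFinP.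
- by move=> t Et; rewrite mule_ge0 ?lee_fin.
- by move: rhn; rewrite inE => -[t _ <-]; rewrite lee_fin.
Qed.

Lemma ge0_integral_density_in (mu nu : {measure set T -> \bar R}) (w : T -> R)
    (f : T -> \bar R) (D : set T) :
  measurable_fun setT w -> (forall x, (0 <= w x)%R) ->
  (forall A, measurable A -> nu A = \int[mu]_(x in A) (w x)%:E) ->
  measurable D -> measurable_fun setT f -> (forall x, 0 <= f x) ->
  \int[nu]_(x in D) f x = \int[mu]_(x in D) (f x * (w x)%:E).
Proof.
move=> mw w0 nuE mD mf f0; rewrite integral_mkcond (ge0_integral_density mw w0 nuE)//.
- rewrite [RHS]integral_mkcond; apply: eq_integral => x _.
  by rewrite !patchE; case: ifP => //; rewrite mul0e.
- by apply/(measurable_restrictT f mD); exact: measurable_funTS.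
- by move=> x; rewrite patchE; case: ifP.
Qed.

(** The push-forward under [phi] of [mu] restricted to [D] has density [w], and the restriction
    itself has density [\1_D]; the density formula is used for both. *)
Lemma ge0_integral_pushforward_density (mu : {measure set T -> \bar R})
    (D : set T) (phi : T -> T) (w : T -> R) (f : T -> \bar R) :
  measurable D -> measurable_fun setT phi ->
  measurable_fun setT w -> (forall x, (0 <= w x)%R) ->
  (forall A, measurable A -> mu (D `&` phi @^-1` A) = \int[mu]_(x in A) (w x)%:E) ->
  measurable_fun setT f -> (forall x, 0 <= f x) ->
  \int[mu]_(x in D) f (phi x) = \int[mu]_x (f x * (w x)%:E).
Proof.
move=> mD mphi mw w0 H mf f0.
pose nu := mrestr mu mD.
rewrite -(@ge0_integral_density mu (pushforward nu phi) w)//; last first.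
  by move=> A mA; rewrite -H// /pushforward /nu /mrestr setIC.
transitivity (\int[nu]_x f (phi x)); last by rewrite ge0_integral_pushforward.
rewrite (@ge0_integral_density mu nu (\1_D) (f \o phi))//=; last 2 first.
- by move=> A mA; rewrite integral_indic// /nu /mrestr setIC.
- exact: (measurableT_comp mf).
by rewrite integral_mkcond; apply: eq_integral => x _; rewrite epatch_indic.
Qed.

End Density.

(** * Square-integrable functions *)

Section L2Theory.
Set Implicit Arguments.
Unset Strict Implicit.
Context {d : measure_display} {T : measurableType d} {R : realType}.
Implicit Types (mu nu : {measure set T -> \bar R}) (f g h : T -> R[i]) (A B : set T).

Lemma cut_cut A B f : cut A (cut B f) = cut (A `&` B) f.
Proof.
by apply/funext => x; rewrite /cut in_setI; case: ifP.
Qed.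

(** The right side has the shape [a * f x + g x] of the linearity clause for [U]. *)
Lemma cut_sub A B f : B `<=` A ->
  cut (A `\` B) f = (fun x => (-1) * cut B f x + cut A f x).
Proof.
move=> BA; apply/funext => x; rewrite /cut in_setD.
case: (boolP (x \in B)) => [xB|xB] /=; last by rewrite mulr0 add0r andbT.
have -> : x \in A by apply/mem_set/BA/set_mem.
by rewrite mulN1r addNr.
Qed.

Lemma cut_setT f : cut setT f = f.
Proof. by apply/funext => x; rewrite /cut in_setT. Qed.

Lemma nrm2_cut mu A f : nrm2 mu (cut A f) = (\int[mu]_(x in A) (cabs2 (f x))%:E)%E.
Proof.
rewrite /nrm2 [RHS]integral_mkcond; apply: eq_integral => x _; exact: ecabs2_cut.
Qed.

Lemma nrm2_ae mu f g : cmeasurable f -> cmeasurable g -> ae_eq mu f g ->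
  nrm2 mu f = nrm2 mu g.
Proof.
move=> mf mg fg; apply: ae_eq_integral => //; try exact: measurable_ecabs2.
by apply: filterS fg => x -> _.
Qed.

Lemma nrm2_eq0 mu f : cmeasurable f -> nrm2 mu f = 0%E -> ae_eq mu f (fun _ => 0).
Proof.
move=> mf f0.
have [+ _] := ae_eq_integral_abs mu measurableT (measurable_ecabs2 measurableT mf).
under eq_integral => x _ do rewrite gee0_abs ?ecabs2_ge0//.
move=> /(_ f0); apply: filterS => x /(_ I) [] /=; exact: cabs2_eq0.
Qed.

Lemma L2_cut mu A f : measurable A -> L2 mu f -> L2 mu (cut A f).
Proof.
move=> mA [mf ff]; split; first exact: cmeasurable_cut.
rewrite nrm2_cut; apply: le_lt_trans ff.
apply: ge0_subset_integral => //; first exact: measurable_ecabs2.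
by move=> x _; exact: ecabs2_ge0.
Qed.

Lemma L2_lin mu (a : R[i]) f g : L2 mu f -> L2 mu g ->
  L2 mu (fun x => a * f x + g x).
Proof.
move=> [mf ff] [mg fg].
have maf : cmeasurable (fun x => a * f x).
  by apply: cmeasurableM => //; exact: cmeasurable_cst.
have mEf := measurable_ecabs2 measurableT mf.
have mEg := measurable_ecabs2 measurableT mg.
split; first exact: cmeasurableD.
apply: (@le_lt_trans _ _
  (\int[mu]_x ((2 * cabs2 a)%:E * (cabs2 (f x))%:E + 2%:E * (cabs2 (g x))%:E))%E).
  apply: ge0_le_integral => //.
  - by move=> x _; exact: ecabs2_ge0.
  - by apply: measurable_ecabs2 => //; exact: cmeasurableD.
  - by apply: emeasurable_funD; exact: emeasurable_funM.
  - move=> x _; rewrite -!EFinM -EFinD lee_fin -mulrA -cabs2M.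
    exact: cabs2D_le.
rewrite ge0_integralD//; last 4 first.
- by move=> x _; rewrite mule_ge0 ?ecabs2_ge0// lee_fin mulr_ge0// cabs2_ge0.
- exact: emeasurable_funM.
- by move=> x _; rewrite mule_ge0 ?ecabs2_ge0// lee_fin.
- exact: emeasurable_funM.
have a0 : (0 <= (2 * cabs2 a)%:E)%E by rewrite lee_fin mulr_ge0// cabs2_ge0.
rewrite !ge0_integralZl//; try by move=> x _; exact: ecabs2_ge0.
by rewrite lte_add_pinfty// lte_mul_pinfty.
Qed.

Lemma L2_cst mu (a : R[i]) : (mu setT < +oo)%E -> L2 mu (fun _ => a).
Proof.
move=> mufin; split; first exact: cmeasurable_cst.
rewrite /nrm2 (integral_cst mu measurableT (cabs2 a)%:E).
by rewrite lte_mul_pinfty ?ecabs2_ge0.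
Qed.

Lemma nrm2_density mu nu h f : cmeasurable h -> cmeasurable f ->
  (forall A, measurable A -> nu A = (\int[mu]_(x in A) (cabs2 (h x))%:E)%E) ->
  nrm2 mu (fun x => h x * f x) = nrm2 nu f.
Proof.
move=> mh mf nuE; rewrite [RHS](ge0_integral_density _ _ nuE).
- by apply: eq_integral => x _; rewrite cabs2M EFinM muleC.
- exact: measurable_cabs2.
- by move=> x; exact: cabs2_ge0.
- exact: measurable_ecabs2.
- by move=> x; exact: ecabs2_ge0.
Qed.

Lemma equiv_measures_ae mu nu (P : T -> Prop) : equiv_measures mu nu ->
  {ae mu, forall x, P x} -> {ae nu, forall x, P x}.
Proof.
by move=> e [N [mN N0 PN]]; exists N; split => //; apply/(e N mN).
Qed.

Lemma measurable_ceq0 h : cmeasurable h -> measurable [set x | h x = 0 :> R[i]].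
Proof.
move=> mh; have := measurable_cabs2 mh measurableT (measurable_set1 (0 : R)).
rewrite setTI; congr measurable; apply/seteqP; split => x /=.
  exact: cabs2_eq0.
by move=> ->; rewrite cabs20.
Qed.

(** The density vanishes on the zero set of [h], which is therefore [nu]-null, hence [mu]-null by
    equivalence. *)
Lemma density_neq0 mu nu h : cmeasurable h -> equiv_measures nu mu ->
  (forall A, measurable A -> nu A = (\int[mu]_(x in A) (cabs2 (h x))%:E)%E) ->
  {ae mu, forall x, h x <> 0 :> R[i]}.
Proof.
move=> mh e nuE; have m0 := measurable_ceq0 mh.
exists [set x | h x = 0 :> R[i]]; split => //; last first.
  by move=> x /= /contrapT.
apply/(e _ m0); rewrite nuE//; apply: integral0_eq => x /= ->.
by rewrite cabs20.
Qed.

(** The unitary is multiplication by [h]; it is onto because [h] is invertible [muT]-almost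
    everywhere. *)
Lemma density_unitarily_equivalent (muS muT : {measure set T -> \bar R})
    (I : Type) (S Tp : I -> (T -> R[i]) -> T -> R[i]) (h : T -> R[i]) :
  cmeasurable h -> equiv_measures muS muT ->
  (forall A, measurable A -> muS A = (\int[muT]_(x in A) (cabs2 (h x))%:E)%E) ->
  (forall l f, L2 muS f ->
    ae_eq muT (fun x => h x * S l f x) (Tp l (fun x => h x * f x))) ->
  unitarily_equivalent muS muT S Tp.
Proof.
move=> mh e muE ST; have h0 := density_neq0 mh e muE.
exists (fun f x => h x * f x); split => //.
- move=> f [mf ff]; split; first exact: cmeasurableM.
  by rewrite (nrm2_density mh mf muE).
- move=> f g _ _ /(equiv_measures_ae e).
  by apply: filterS => x ->.
- move=> a f g _ _; apply: aeW => x.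
  by rewrite mulrDr mulrCA.
- split=> [f [mf _]|g [mg fg]]; first exact: nrm2_density.
  have mgh : cmeasurable (fun x => (h x)^-1 * g x).
    by apply: cmeasurableM => //; exact: cmeasurableV.
  have hgh : ae_eq muT (fun x => h x * ((h x)^-1 * g x)) g.
    by apply: filterS h0 => x /eqP hx; rewrite mulVKf.
  exists (fun x => (h x)^-1 * g x) => //; split => //.
  (* The isometry is read backwards: the norm of $h^{-1}g$ under [muS] is that of $h\,h^{-1}g=g$
     under [muT]. *)
  rewrite -(nrm2_density mh mgh muE) (nrm2_ae _ mg hgh)//.
  exact: cmeasurableM.
Qed.

End L2Theory.

(** * Unitaries commuting with indicators *)

Section Unitary.
Set Implicit Arguments.
Unset Strict Implicit.
Context {d : measure_display} {T : measurableType d} {R : realType}.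
Implicit Types (f g : T -> R[i]) (A B : set T).

(** These are the clauses of [unitarily_equivalent] without the intertwining one, so [U] can be
    studied on any measurable space. *)
Definition unitary (muS muT : {measure set T -> \bar R})
    (U : (T -> R[i]) -> T -> R[i]) : Prop :=
  [/\ (forall f, L2 muS f -> L2 muT (U f)),
      (forall f g, L2 muS f -> L2 muS g -> ae_eq muS f g ->
        ae_eq muT (U f) (U g)),
      (forall (a : R[i]) f g, L2 muS f -> L2 muS g ->
        ae_eq muT (U (fun x => a * f x + g x)) (fun x => a * U f x + U g x)),
      (forall f, L2 muS f -> nrm2 muT (U f) = nrm2 muS f) &
      (forall g, L2 muT g -> exists2 f, L2 muS f & ae_eq muT (U f) g)].

(** Measurability is bundled in so that the sets satisfying this form a sigma-algebra. *)
Definition commutes_cut (muS muT : {measure set T -> \bar R})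
    (U : (T -> R[i]) -> T -> R[i]) (A : set T) : Prop :=
  measurable A /\
  forall g, L2 muS g -> ae_eq muT (U (cut A g)) (cut A (U g)).

Context {muS muT : {measure set T -> \bar R}} {U : (T -> R[i]) -> T -> R[i]}.
Hypothesis uU : unitary muS muT U.
Local Notation D := (commutes_cut muS muT U).

Lemma commutes_cut_diff A B : B `<=` A -> D A -> D B -> D (A `\` B).
Proof.
have [_ _ Ulin _ _] := uU.
move=> BA [mA UA] [mB UB]; split=> [|g gL]; first exact: measurableD.
rewrite cut_sub//.
have := Ulin (-1) _ _ (L2_cut mB gL) (L2_cut mA gL).
move: (UA _ gL) (UB _ gL); apply: filterS3 => x e1 e2 ->.
by rewrite cut_sub// e1 e2.
Qed.

Lemma commutes_cut_setT : D setT.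
Proof. by split=> // g _; apply: aeW => x; rewrite !cut_setT. Qed.

Lemma commutes_cutI A B : D A -> D B -> D (A `&` B).
Proof.
move=> [mA UA] [mB UB]; split=> [|g gL]; first exact: measurableI.
rewrite -!cut_cut; move: (UA _ (L2_cut mB gL)) (UB _ gL).
by apply: filterS2 => x -> e; rewrite /cut; case: ifP => // _; rewrite e.
Qed.

Lemma commutes_cutC A : D A -> D (~` A).
Proof. by move=> DA; rewrite -setTD; exact: commutes_cut_diff commutes_cut_setT DA. Qed.

Lemma commutes_cutU A B : D A -> D B -> D (A `|` B).
Proof.
move=> DA DB; rewrite -[_ `|` _]setCK setCU.
by apply: commutes_cutC; apply: commutes_cutI; exact: commutes_cutC.
Qed.

(** Dominated convergence with bound $|g|^2$: every point eventually leaves the decreasing sets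
    [F n]. *)
Lemma cvg_nrm2_cut mu g (F : (set T)^nat) : L2 mu g ->
  (forall n, measurable (F n)) ->
  (forall n m, (n <= m)%N -> F m `<=` F n) -> \bigcap_n F n = set0 ->
  nrm2 mu (cut (F n) g) @[n --> \oo] --> (0 : \bar R).
Proof.
move=> [mg fg] mF ndF F0.
have -> : (0 = \int[mu]_x (0 : \bar R))%E by rewrite integral0.
apply: (@dominated_cvg _ _ _ mu setT measurableT
  (fun n x => (cabs2 (cut (F n) g x))%:E) (fun _ => 0%E)
  (fun x => (cabs2 (g x))%:E)) => //.
- by move=> n; apply: measurable_ecabs2 => //; exact: cmeasurable_cut.
- move=> x _.
  have [n nFx] : exists n, ~ F n x.
    apply/existsNP => xF.
    by have : (\bigcap_n F n) x by []; rewrite F0.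
  apply: cvg_near_cst; exists n => // m /= nm.
  rewrite /cut memNset ?cabs20//.
  by move=> /(ndF _ _ nm).
- apply/integrableP; split; first exact: measurable_ecabs2.
  by under eq_integral => x _ do rewrite gee0_abs ?ecabs2_ge0//.
- move=> n x _; rewrite gee0_abs ?ecabs2_ge0// /cut; case: ifP => // _.
  by rewrite cabs20 ecabs2_ge0.
Qed.

(* Off the union [A] of the increasing sets [B n], the function [U (1_A g)]
   agrees with [U (1_(A \ B n) g)], whose norm tends to 0. *)
Lemma commutes_cut_bigcup (F : (set T)^nat) : (forall n, D (F n)) ->
  D (\bigcup_n F n).
Proof.
have [UL _ Ulin Unrm _] := uU.
move=> DF; pose B n := \big[setU/set0]_(i < n.+1) F i.
have DB n : D (B n).
  apply: (@big_ind _ D) => //; last exact: commutes_cutU.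
  by rewrite -setCT; exact: commutes_cutC commutes_cut_setT.
have mB n : measurable (B n) by have [] := DB n.
set A := \bigcup_n F n.
have AB : A = \bigcup_n B n by rewrite bigcup_bigsetU_bigcup.
have mA : measurable A by rewrite AB; exact: bigcupT_measurable.
have BA n : B n `<=` A by rewrite AB; exact: bigcup_sup.
have ndB n m : (n <= m)%N -> B n `<=` B m by move=> nm; exact: subset_bigsetU.
split=> // g gL.
have gAL := L2_cut mA gL; have UgL := UL _ gL; have GL := UL _ gAL.
(* On [B n] both sides equal [U (cut (B n) g)], because [B n] commutes with [U] and lies in [A];
   countably many null sets are discarded. *)
have onA : {ae muT, forall x, A x -> U (cut A g) x = U g x}.
  have : {ae muT, forall x n, B n x -> U (cut A g) x = U g x}.
    apply: ae_foralln => n; have [_ UB] := DB n.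
    move: (UB _ gAL) (UB _ gL); rewrite cut_cut (setIidl (@BA n)).
    apply: filterS2 => x -> + Bx; rewrite /cut mem_set//.
  apply: filterS => x Hx Ax.
  by have [n _ /Hx] : (\bigcup_n B n) x by rewrite -AB.
have off n : (nrm2 muT (cut (~` A) (U (cut A g))) <= nrm2 muS (cut (A `\` B n) g))%E.
  have mAB : measurable (A `\` B n) by exact: measurableD.
  rewrite -Unrm; last exact: L2_cut.
  rewrite -(cut_setT (U (cut (A `\` B n) g))) !nrm2_cut.
  have UB := (DB n).2.
  have eB : ae_eq muT (cut (~` A) (U (cut A g))) (cut (~` A) (U (cut (A `\` B n) g))).
    rewrite cut_sub//.
    move: (Ulin (-1) _ _ (L2_cut (mB n) gL) gAL) (UB _ gL).
    apply: filterS2 => x e1 e2; rewrite /cut; case: ifP => // /set_mem nAx.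
    rewrite e1 e2 {1}/cut memNset ?mulr0 ?add0r//.
    by move=> /BA.
  rewrite -nrm2_cut (nrm2_ae _ _ eB) ?nrm2_cut.
  - apply: ge0_subset_integral => //; first exact: measurableC.
      by apply: measurable_ecabs2 => //; have [] := UL _ (L2_cut mAB gL).
    by move=> x _; exact: ecabs2_ge0.
  - by apply: cmeasurable_cut; [exact: measurableC|have [] := GL].
  - by apply: cmeasurable_cut; [exact: measurableC|have [] := UL _ (L2_cut mAB gL)].
have offA : nrm2 muT (cut (~` A) (U (cut A g))) = 0%E.
  apply/eqP; rewrite eq_le; apply/andP; split; last first.
    by apply: integral_ge0 => x _; exact: ecabs2_ge0.
  apply: (cvge_ge (f := fun n => nrm2 muS (cut (A `\` B n) g)) (F := \oo)).
    by apply: nearW => n; exact: off.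
  apply: cvg_nrm2_cut => //.
  - by move=> n; exact: measurableD.
  - by move=> n m nm; apply: setDS; exact: ndB.
  - rewrite -subset0 => x Hx; have [Ax _] := Hx 0%N I.
    by move: (Ax); rewrite AB => -[n _ Bx]; have [_] := Hx n I.
move: (nrm2_eq0 (cmeasurable_cut (measurableC mA) (proj1 GL)) offA) onA.
apply: filterS2 => x; rewrite /cut; have [xA|xA] := boolP (x \in A).
  by move=> _ /(_ (set_mem xA)).
by rewrite in_setC xA.
Qed.

Lemma commutes_cut_sigma_algebra : sigma_algebra setT D.
Proof.
split; first by rewrite -setCT; exact: commutes_cutC commutes_cut_setT.
- by move=> A DA; rewrite setTD; exact: commutes_cutC.
- exact: commutes_cut_bigcup.
Qed.

Hypothesis finS : (muS setT < +oo)%E.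
Hypothesis cU : forall A, measurable A -> D A.

Let h := U (fun _ => 1).

(** The isometry is applied to the indicator of [A], which [U] sends to [cut A h]. *)
Lemma unitary_density A : measurable A ->
  muS A = (\int[muT]_(x in A) (cabs2 (h x))%:E)%E.
Proof.
have [UL _ _ Unrm _] := uU; have L1 := L2_cst (1 : R[i]) finS.
move=> mA; have [_ UA] := cU mA.
rewrite -nrm2_cut -(nrm2_ae _ _ (UA _ L1)).
- rewrite Unrm; last exact: L2_cut.
  rewrite nrm2_cut cabs21 integral_cst//; first by rewrite mul1e.
- by have [] := UL _ (L2_cut mA L1).
- by apply: cmeasurable_cut => //; have [] := UL _ L1.
Qed.

Lemma unitary_cabs2 (c : R[i]) f : L2 muS f ->
  {ae muT, forall x, cabs2 (U f x - c * h x) = cabs2 (f x - c) * cabs2 (h x)}.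
Proof.
have [UL _ Ulin Unrm _] := uU; have L1 := L2_cst (1 : R[i]) finS.
move=> fL.
have mh : cmeasurable h by have [] := UL _ L1.
have fcL : L2 muS (fun x => f x - c).
  have := L2_lin (- c) L1 fL; congr L2.
  by apply/funext => x; rewrite mulr1 addrC.
have Ufc : ae_eq muT (U (fun x => f x - c)) (fun x => U f x - c * h x).
  have -> : (fun x => f x - c) = (fun x => - c * 1 + f x).
    by apply/funext => x; rewrite mulr1 addrC.
  apply: filterS (Ulin (- c) _ _ L1 fL) => x ->.
  by rewrite addrC mulNr.
have mUf : cmeasurable (U f) by have [] := UL _ fL.
have UfcL : L2 muT (fun x => U f x - c * h x).
  have := L2_lin (- c) (UL _ L1) (UL _ fL); congr L2.
  by apply/funext => x; rewrite addrC mulNr.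
have mR : measurable_fun setT (fun x => cabs2 (f x - c) * cabs2 (h x)).
  by apply: measurable_funM; apply: measurable_cabs2 => //; have [] := fcL.
have := @integral_ae_eq _ _ _ muT setT measurableT
  (fun x => (cabs2 (f x - c) * cabs2 (h x))%:E)
  (fun x => (cabs2 (U f x - c * h x))%:E).
have H1 : muT.-integrable setT (fun x => (cabs2 (U f x - c * h x))%:E).
  apply/integrableP; split; first by apply: measurable_ecabs2 => //; have [] := UfcL.
  under eq_integral => x _ do rewrite gee0_abs ?ecabs2_ge0//.
  by have [] := UfcL.
move=> /(_ H1) H; have {}H := H ((measurable_EFinP _ _).2 mR).
(* Equality of the integrals over all measurable sets suffices, as the left integrand is integrable.
   On [A] the left integral is the squared norm of the image of [cut A (f - c)], which the isometry
   and the density $|h|^2$ turn into the right one. *)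
suff HA A : A `<=` setT -> measurable A ->
    (\int[muT]_(x in A) (cabs2 (U f x - c * h x))%:E =
     \int[muT]_(x in A) (cabs2 (f x - c) * cabs2 (h x))%:E)%E.
  by apply: filterS (H HA) => x /(_ I) [].
move=> _ mA; have [_ UA] := cU mA.
rewrite -nrm2_cut.
have e : ae_eq muT (cut A (fun x => U f x - c * h x)) (U (cut A (fun x => f x - c))).
  move: (UA _ fcL) Ufc; apply: filterS2 => x -> e.
  by rewrite /cut; case: ifP.
rewrite (nrm2_ae _ _ e).
- rewrite Unrm; last exact: L2_cut.
  rewrite nrm2_cut (ge0_integral_density_in _ _ unitary_density)//.
  + exact: measurable_cabs2.
  + by move=> x; exact: cabs2_ge0.
  + by apply: measurable_ecabs2 => //; have [] := fcL.
  + by move=> x; exact: ecabs2_ge0.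
- by apply: cmeasurable_cut => //; have [] := UfcL.
- by have [] := UL _ (L2_cut mA fcL).
Qed.

Lemma unitary_mul f : L2 muS f -> ae_eq muT (U f) (fun x => h x * f x).
Proof.
move=> fL.
move: (unitary_cabs2 0 fL) (unitary_cabs2 1 fL) (unitary_cabs2 'i%C fL).
apply: filterS3 => x e0 e1 ei.
(* Where [h] vanishes, the case $c=0$ gives [U f x = 0]. Elsewhere, dividing by $|h|^2$ shows that
   [U f x / h x] and [f x] have equal distances to $0$, $1$ and $i$. *)
have [hx|hx] := eqVneq (h x) 0.
  move: e0; rewrite hx cabs20 !mulr0 subr0 mul0r; exact: cabs2_eq0.
have hx2 : cabs2 (h x) != 0 by apply: contra_neq hx; exact: cabs2_eq0.
have E c : cabs2 (U f x - c * h x) = cabs2 (f x - c) * cabs2 (h x) ->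
    cabs2 (U f x / h x - c) = cabs2 (f x - c).
  move=> e; apply: (mulIf hx2); rewrite -e -cabs2M mulrBl mulfVK//.
rewrite -[LHS](mulfVK hx) mulrC; congr (_ * _).
apply: cabs2_inj; [|exact: E|exact: E].
by have := E 0 e0; rewrite !subr0.
Qed.

(** A [muT]-null set is [muS]-null by the density formula. Conversely, surjectivity provides [f]
    with $Uf=1$, and then $\mu_T(A)=\|U(1_Af)\|^2=\int_A|f|^2\,d\mu_S$. *)
Lemma unitary_equiv_measures : (muT setT < +oo)%E -> equiv_measures muS muT.
Proof.
have [UL _ _ Unrm Usurj] := uU.
move=> finT A mA; split=> A0; last first.
  rewrite unitary_density// null_set_integral//.
  by apply: measurable_ecabs2 => //; have [] := UL _ (L2_cst (1 : R[i]) finS).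
have [_ UA] := cU mA.
have LT1 := L2_cst (1 : R[i]) finT.
have [f fL Uf] := Usurj _ LT1.
have e : ae_eq muT (cut A (fun _ => 1)) (U (cut A f)).
  move: (UA _ fL) Uf; apply: filterS2 => x -> e.
  by rewrite /cut; case: ifP.
have : nrm2 muT (cut A (fun _ => 1 : R[i])) = 0%E.
  rewrite (nrm2_ae _ _ e).
  - rewrite Unrm; last exact: L2_cut.
    rewrite nrm2_cut null_set_integral//.
    by apply: measurable_ecabs2 => //; have [] := fL.
  - by apply: cmeasurable_cut => //; have [] := LT1.
  - by have [] := UL _ (L2_cut mA fL).
by rewrite nrm2_cut cabs21 integral_cst// mul1e.
Qed.

End Unitary.

(** * The path space of a projective system *)

(** The index type is bare, as [kmor L] is; [{classic I}] equips it with the structure needed to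
    enumerate [A] by a sequence. *)
Lemma bigcup_finite_ind (I T : Type) (A : set I) (F : I -> set T)
    (P : set T -> Prop) : finite_set A -> P set0 ->
  (forall B C, P B -> P C -> P (B `|` C)) -> (forall i, A i -> P (F i)) ->
  P (\bigcup_(i in A) F i).
Proof.
move=> finA P0 PU PF.
have /finite_seqP[s As] : finite_set (A : set {classic I}) by [].
have -> : \bigcup_(i in A) F i =
    \big[setU/set0]_(i <- s) (F : {classic I} -> set T) i.
  by rewrite -(@bigcup_seq {classic I} T) -As.
have {}PF (i : {classic I}) : i \in s -> P (F i).
  by move=> si; apply: PF; have : [set` s] i by []; rewrite -As.
elim: s {As} PF => [|i s IH] PF; first by rewrite big_nil.
rewrite big_cons; apply: PU; first by apply: PF; rewrite mem_head.
by apply: IH => j js; apply: PF; rewrite in_cons js orbT.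
Qed.

Section PathSpace.
Set Implicit Arguments.
Unset Strict Implicit.
Context {R : realType} {k : nat} {L : kgraph k} {x0 : kpath L}.
Implicit Types (l m : kmor L) (n : Nk k).
Local Notation X := (Linf x0).

Lemma measurable_cyl l : measurable (cyl l : set X).
Proof. by apply: sub_sigma_algebra; exists l. Qed.

(** Since there are countably many morphisms, this is a countable union of cylinders of degree
    [n]. *)
Lemma measurable_kpath_seg n (P : kmor L -> Prop) :
  measurable ([set x | P (kpath_seg x n)] : set X).
Proof.
rewrite (_ : [set x | _] =
    \bigcup_(l : kmor L) [set x : X | cyl l x /\ (P l /\ kd l = n)]); last first.
  apply/seteqP; split => [x /= Px|x [l _ /= [lx [Pl <-]]]]; last first.
    by rewrite [kpath_seg _ _]lx.
  by exists (kpath_seg x n) => //=; rewrite /cyl /= kd_kpath_seg.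
apply: countable_bigcupT_measurable.
  have [c cinj] := kmor_countable L.
  by apply/countable_injP; exists c => i j _ _; exact: cinj.
move=> l; have [H|H] := pselect (P l /\ kd l = n).
  rewrite (_ : [set x | _] = cyl l); first exact: measurable_cyl.
  by apply/seteqP; split => [x []|x].
rewrite (_ : [set x | _] = set0) //.
by apply/seteqP; split => [x []|x].
Qed.

(** It suffices to pull back cylinders: $\sigma^n(x)\in Z(m)$ says that the segment of $x$ of degree
    $n+d(m)$ ends in $m$. *)
Lemma measurable_kshift n : measurable_fun setT (kshift n : X -> X).
Proof.
refine (@measurability _ _ X X _ _ (@cylinders k L x0) erefl _).
move=> _ [_ [m ->] <-]; rewrite setTI.
rewrite (_ : _ @^-1` _ = [set x : X | exists a,
  [/\ ks a = kr m, kd a = n & kpath_seg x (addNk n (kd m)) = kcomp a m]]).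
  exact: (@measurable_kpath_seg _ (fun l => exists a,
    [/\ ks a = kr m, kd a = n & l = kcomp a m])).
apply/seteqP; split => x /=; have [e1 e2] := kpath_seg_shift x n (kd m).
  move=> xm; exists (kpath_seg x n); rewrite kd_kpath_seg.
  by move: e1 e2; rewrite [kpath_seg (kshift n x) _]xm.
move=> [a [e3 e4 e5]]; rewrite /cyl /=.
by apply: (kfactor_injr e1 e3); rewrite ?kd_kpath_seg// -e2.
Qed.

(* Off [Z(s l)] the epsilon term [prefix l] need not be measurable. *)
Definition prefixT l (x : X) : X :=
  if x \in (cyl (kid (ks l)) : set X) then prefix l x else x.

Lemma prefixTE l (x : X) : cyl (kid (ks l)) x -> prefixT l x = prefix l x.
Proof. by move=> lx; rewrite /prefixT mem_set. Qed.

(** On $Z(s(l))$, the path $lx$ lies in $Z(m)$ exactly when its segment $l\,x(0,d(m))$ begins with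
    $m$, a condition on one segment of $x$. *)
Lemma measurable_prefixT l : measurable_fun setT (prefixT l).
Proof.
refine (@measurability _ _ X X _ _ (@cylinders k L x0) erefl _).
move=> _ [_ [m ->] <-]; rewrite setTI.
set Z : set X := cyl (kid (ks l)).
have mZ : measurable Z by exact: measurable_cyl.
rewrite (_ : _ @^-1` _ = (Z `&` [set x : X | exists b,
  ks m = kr b /\ kcomp l (kpath_seg x (kd m)) = kcomp m b])
  `|` (~` Z `&` cyl m)).
  apply: measurableU; apply: measurableI => //.
  - exact: (@measurable_kpath_seg _ (fun w => exists b,
      ks m = kr b /\ kcomp l w = kcomp m b)).
  - exact: measurableC.
  - exact: measurable_cyl.
apply/seteqP; split => [x /=|x /= [[Zx]|[Zx]]].
- have [Zx|Zx] := pselect (Z x); last by rewrite /prefixT memNset//; right.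
  rewrite prefixTE// => ym; left; split=> //.
  have [yl yx] := prefixP Zx.
  have [_ e2] := kpath_seg_shift (prefix l x) (kd l) (kd m).
  have [e3 e4] := kpath_seg_shift (prefix l x) (kd m) (kd l).
  exists (kpath_seg (kshift (kd m) (prefix l x)) (kd l)).
  move: e2 e3 e4; rewrite yx yl addNkC => -> e3 e4.
  by move: e3 e4; rewrite [kpath_seg (prefix l x) (kd m)]ym.
- rewrite prefixTE// => -[b [mb e]].
  have [yl yx] := prefixP Zx.
  have [_ e2] := kpath_seg_shift (prefix l x) (kd l) (kd m).
  have [e3 e4] := kpath_seg_shift (prefix l x) (kd m) (kd l).
  apply: (kfactor_injl e3 mb); first by rewrite kd_kpath_seg.
  by rewrite -e4 addNkC e2 yx yl.
- by rewrite /prefixT memNset.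
Qed.

Context {mu : {measure set X -> \bar R}} {f : kmor L -> X -> R[i]}.
Hypothesis pf : proj_system mu f.

(** The finitely many cylinders of degree $0$ cover the space, and each has measure $\|f_l\|^2$ by
    the push-forward clause on the whole space. *)
Lemma proj_system_finite : finite_kgraph L -> (mu setT < +oo)%E.
Proof.
have [[part _ _] fL push _ _] := pf; move=> finL.
have -> : (setT : set X) = \bigcup_(l in [set l | kd l = @zeroNk k]) cyl l.
  apply/seteqP; split => // x _; have [l [[l1 l2] _]] := part (@zeroNk k) x.
  by exists l.
suff [] : measurable (\bigcup_(l in [set l | kd l = @zeroNk k]) cyl l : set X) /\
  (mu (\bigcup_(l in [set l | kd l = @zeroNk k]) cyl l) < +oo)%E by [].
apply: (@bigcup_finite_ind _ X _ _ (fun B => measurable B /\ (mu B < +oo)%E)) => //.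
- by rewrite measure0.
- move=> B C [mB Bfin] [mC Cfin]; split; first exact: measurableU.
  apply: le_lt_trans (lte_add_pinfty Bfin Cfin).
  exact: measureU2.
- move=> l l0; split; first exact: measurable_cyl.
  have := push l setT measurableT; rewrite preimage_setT setIT.
  have -> : ks l = kr l by rewrite {1}(kmor_deg0 l0) ks_id.
  by rewrite -kmor_deg0// => ->; have [] := fL l.
Qed.

(** The push-forward under $\sigma_l$ is carried by $Z(l)$, so its density $|f_l|^2$ integrates to
    $0$ off $Z(l)$. *)
Lemma proj_system_support l : {ae mu, forall x, ~ cyl l x -> f l x = 0}.
Proof.
have [_ fL push _ _] := pf; have [mf _] := fL l.
have mC : measurable (~` cyl l : set X) by apply: measurableC; exact: measurable_cyl.
have : nrm2 mu (cut (~` cyl l : set X) (f l)) = 0%E.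
  rewrite nrm2_cut -push// (_ : _ `&` _ = set0) ?measure0//.
  by rewrite -subset0 => x [/prefixP[yl _]].
move=> /(nrm2_eq0 (cmeasurable_cut mC mf)); apply: filterS => x + xl.
by rewrite /cut mem_set.
Qed.

(** The witness is $F=(g/f_l)\circ\sigma_l$ on $Z(s(l))$ and $0$ elsewhere. By change of variables
    $\|F\|^2=\int|g/f_l|^2|f_l|^2\,d\mu\le\|g\|^2$. *)
Lemma cut_cyl_range l g : L2 mu g -> exists F,
  [/\ L2 mu F, L2 mu (proj_rep f l F) & ae_eq mu (proj_rep f l F) (cut (cyl l : set X) g)].
Proof.
have [_ fL push fn0 _] := pf; have [mf _] := fL l.
move=> gL; have [mg gfin] := gL.
set Z : set X := cyl (kid (ks l)).
have mZ : measurable Z by exact: measurable_cyl.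
pose q x := g x / f l x.
have mq : cmeasurable q by apply: cmeasurableM => //; exact: cmeasurableV.
have mqp : cmeasurable (fun x => q (prefixT l x)).
  by apply: cmeasurable_comp => //; exact: measurable_prefixT.
have FL : L2 mu (cut Z (fun x => q (prefixT l x))).
  split; first exact: cmeasurable_cut.
  rewrite nrm2_cut (@ge0_integral_pushforward_density _ _ _ mu Z (prefixT l)
    (fun x => cabs2 (f l x)) (fun x => (cabs2 (q x))%:E))//.
  - apply: le_lt_trans gfin; apply: ge0_le_integral => //.
    + by move=> x _; rewrite mule_ge0// ecabs2_ge0.
    + by apply: emeasurable_funM; exact: measurable_ecabs2.
    + exact: measurable_ecabs2.
    + move=> x _; rewrite -EFinM lee_fin -cabs2M.
      (* Where [f l] vanishes the product is $0$, so only an inequality holds there. *)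
      have [->|fx] := eqVneq (f l x) 0; last by rewrite mulfVK.
      by rewrite mulr0 cabs20 cabs2_ge0.
  - exact: measurable_prefixT.
  - exact: measurable_cabs2.
  - by move=> x; exact: cabs2_ge0.
  - move=> A mA; rewrite -push//; congr (mu _); apply/seteqP.
    by split=> x /= [Zx]; rewrite prefixTE.
  - exact: measurable_ecabs2.
  - by move=> x; exact: ecabs2_ge0.
have e : ae_eq mu (proj_rep f l (cut Z (fun x => q (prefixT l x)))) (cut (cyl l : set X) g).
  move: (proj_system_support l) (fn0 l).
  apply: (@filterS2 _ _ (ae_filter_ringOfSetsType mu)) => x e1 e2.
  rewrite /proj_rep; have [lx|lx] := pselect (cyl l x).
    rewrite /cut !mem_set//; last exact: cyl_shift.
    rewrite prefixTE; last exact: cyl_shift.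
    by rewrite shiftK// /q mulrC mulfVK// e2.
  by rewrite e1// mul0r /cut memNset.
have mS : cmeasurable (proj_rep f l (cut Z (fun x => q (prefixT l x)))).
  apply: cmeasurableM => //.
  exact: (@cmeasurable_comp _ _ X _ X _ _ (measurable_kshift (kd l)) (proj1 FL)).
have mc := measurable_cyl l.
exists (cut Z (fun x => q (prefixT l x))); split => //; split => //.
by rewrite (nrm2_ae mS _ e); have [] := L2_cut mc gL.
Qed.

End PathSpace.

(** * Intertwining unitaries commute with Borel indicators *)

Section Intertwiner.
Set Implicit Arguments.
Unset Strict Implicit.
Context {R : realType} {k : nat} {L : kgraph k} {x0 : kpath L}.
Context {muS muT : {measure set (Linf x0) -> \bar R}}.
Context {fS fT : kmor L -> Linf x0 -> R[i]}.
Context {U : (Linf x0 -> R[i]) -> Linf x0 -> R[i]}.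
Hypothesis finL : finite_kgraph L.
Hypothesis pS : proj_system muS fS.
Hypothesis pT : proj_system muT fT.
Hypothesis uU : unitary muS muT U.
Hypothesis UST : forall l f, L2 muS f ->
  ae_eq muT (U (proj_rep fS l f)) (proj_rep fT l (U f)).

(** This is half of commuting with the indicator of [A]; the other half is the same property for the
    complement. *)
Definition preserves_support (A : set (Linf x0)) : Prop :=
  measurable A /\
  forall g, L2 muS g -> {ae muT, forall x, ~ A x -> U (cut A g) x = 0}.

(** The function [cut (cyl l) g] is some $S_lF$, so its image is $T_lUF$, which carries the factor
    $f^T_l$ supported on $Z(l)$. *)
Lemma preserves_support_cyl l : preserves_support (cyl l).
Proof.
have [_ Uae _ _ _] := uU; have mc := @measurable_cyl k L x0 l.
split=> // g gL; have [F [FL SFL e]] := cut_cyl_range pS l gL.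
move: (Uae _ _ SFL (L2_cut mc gL) e) (UST l FL) (proj_system_support pT l).
by apply: filterS3 => x <- -> H /H; rewrite /proj_rep => ->; rewrite mul0r.
Qed.

(** The function is split into its part on [A] and its part on [B] outside [A]. *)
Lemma preserves_supportU A B : preserves_support A -> preserves_support B ->
  preserves_support (A `|` B).
Proof.
have [_ _ Ulin _ _] := uU.
move=> [mA UA] [mB UB]; split=> [|g gL]; first exact: measurableU.
have gcL : L2 muS (cut (~` A) g) by apply: L2_cut => //; exact: measurableC.
have -> : cut (A `|` B) g = (fun x => 1 * cut A g x + cut B (cut (~` A) g) x).
  apply/funext => x; rewrite /cut in_setU in_setC mul1r.
  by case: (x \in A) => /=; case: (x \in B) => /=; rewrite ?addr0 ?add0r.
move: (UA _ gL) (UB _ gcL) (Ulin 1 _ _ (L2_cut mA gL) (L2_cut mB gcL)).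
apply: filterS3 => x e1 e2 -> nAB.
by rewrite e1 ?e2 ?mulr0 ?addr0// => H; apply: nAB; [right|left].
Qed.

Lemma preserves_support0 : preserves_support set0.
Proof.
have [UL _ _ Unrm _] := uU; split=> // g gL.
have g0L : L2 muS (cut set0 g) by exact: L2_cut.
have : nrm2 muT (U (cut set0 g)) = 0%E by rewrite Unrm// nrm2_cut integral_set0.
move=> /(nrm2_eq0 (proj1 (UL _ g0L))); apply: filterS => x + _; exact.
Qed.

(** The complement of $Z(l)$ is the finite union of the other cylinders of degree $d(l)$, so it too
    preserves supports. The images of the two parts of [g] then have disjoint supports and add up to
    [U g]. *)
Lemma commutes_cut_cyl l : commutes_cut muS muT U (cyl l).
Proof.
have [_ _ Ulin _ _] := uU; have [[part _ _] _ _ _ _] := pS.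
have [mc Uc] := preserves_support_cyl l.
have [_ UC] : preserves_support (~` cyl l).
  have -> : (~` cyl l : set (Linf x0)) =
      \bigcup_(m in [set m | kd m = kd l /\ m <> l]) cyl m.
    apply/seteqP; split => [x /= lx|x [m /= [dm ml] mx] lx].
      have [m [[dm mx] _]] := part (kd l) x.
      by exists m => //; split=> // ml; apply: lx; rewrite -ml.
    by apply: ml; move: mx lx; rewrite /cyl /= dm => -> ->.
  apply: bigcup_finite_ind.
  - by apply: sub_finite_set (finL (kd l)) => m [].
  - exact: preserves_support0.
  - exact: preserves_supportU.
  - by move=> m _; exact: preserves_support_cyl.
split=> // g gL.
have gC : L2 muS (cut (~` cyl l : set (Linf x0)) g) by apply: L2_cut => //; exact: measurableC.
have e : U g = U (fun x => 1 * cut (cyl l : set (Linf x0)) g x +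
    cut (~` cyl l : set (Linf x0)) g x).
  congr U; apply/funext => x; rewrite /cut in_setC mul1r.
  by case: (x \in _); rewrite ?addr0 ?add0r.
move: (Uc _ gL) (UC _ gL) (Ulin 1 _ _ (L2_cut mc gL) gC).
apply: filterS3 => x e1 e2; rewrite -e => e3.
rewrite [RHS]/cut e3 mul1r; have [lx|lx] := pselect (cyl l x).
  by rewrite mem_set// e2 ?addr0//; exact.
by rewrite memNset// e1.
Qed.

Lemma commutes_cut_measurable A : measurable A -> commutes_cut muS muT U A.
Proof.
move: A; apply: smallest_sub; first exact: commutes_cut_sigma_algebra.
by move=> _ [l ->]; exact: commutes_cut_cyl.
Qed.

End Intertwiner.

Theorem mainTheorem13 (R : realType) (k : nat) (L : kgraph k) (x0 : kpath L)
    (muS muT : {measure set (Linf x0) -> \bar R})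
    (fS fT : kmor L -> Linf x0 -> R[i]) :
  finite_kgraph L -> no_sources L ->
  proj_system muS fS -> proj_system muT fT ->
  (unitarily_equivalent muS muT (proj_rep fS) (proj_rep fT) <->
   (equiv_measures muS muT /\
    exists h : Linf x0 -> R[i],
      [/\ cmeasurable h,
          forall A : set (Linf x0), measurable A ->
            muS A = (\int[muT]_(x in A) (cabs2 (h x))%:E)%E
        & forall l : kmor L,
            {ae muT, forall x, fS l x = h (kshift (kd l) x) / h x * fT l x}])).
Proof.
move=> finL _ pS pT; split; last first.
  move=> [e [h [mh muE hf]]].
  have h0 := density_neq0 mh e muE.
  apply: (density_unitarily_equivalent mh e muE) => l f fL.
  move: h0 (hf l); apply: filterS2 => x /eqP hx.
  rewrite /proj_rep => ->.
  by rewrite !mulrA [h x * _]mulrC mulfK// [fT l x * _]mulrC.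
move=> [U [UL Uae Ulin [Unrm Usurj] UST]].
have uU : unitary muS muT U by [].
have finS := proj_system_finite pS finL.
have finT := proj_system_finite pT finL.
have cU := commutes_cut_measurable finL pS pT uU UST.
have L1 : L2 muS (fun _ => 1) by exact: L2_cst.
have e := unitary_equiv_measures uU finS cU finT.
have muE := unitary_density uU finS cU.
have mh : cmeasurable (U (fun _ => 1)) by have [] := UL _ L1.
split=> //; exists (U (fun _ => 1)); split => // l.
have [_ fSL _ _ _] := pS.
have fS1 : proj_rep fS l (fun _ => 1) = fS l.
  by apply/funext => x; rewrite /proj_rep mulr1.
(* As $S_l1=f^S_l$ is square-integrable, $U S_l1=h f^S_l$; the intertwining relation equates this
   with $T_lh=f^T_l\,(h\circ\sigma^{d(l)})$, and [h] can be divided out almost everywhere. *)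
move: (density_neq0 mh e muE) (unitary_mul uU finS cU (fSL l)) (UST l _ L1).
apply: filterS3 => x /eqP hx; rewrite fS1 => -> /(congr1 (fun z => z / U (fun _ => 1) x)).
by rewrite mulrAC divff// mul1r /proj_rep => ->; rewrite [RHS]mulrC mulrA.
Qed.
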